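(* Let $m$ be a positive integer and $G$ a graph such that for all $S\subseteq V(G)$ $$\frac{m+1}{2}\,iso(G\setminus S)+\omega(G\setminus S)\le \frac{1}{m}|S|+1.$$ Then for every vertex $u\in V(G)$, $G$ has an $m$-tree-connected spanning subgraph $H$ such that $d_H(v)\le 2m+1$ for every vertex $v$ and $d_H(u)\le m+1$.
   Context: Graphs are finite, have no loops, but may have multiple edges; degrees count multiplicities. For $S\subseteq V(G)$, $G\setminus S$ is the graph obtained by deleting $S$; $\omega(\cdot)$ is the number of connected components and $iso(\cdot)$ the number of isolated vertices. A graph is $m$-tree-connected if it contains $m$ edge-disjoint spanning trees. *)

(* Defs.v *)
(* A finite loopless multigraph G is given by a finite vertex
   type V, a finite edge type E, and an endpoint map ep : E -> V * V with
   (ep e).1 != (ep e).2 for all e (parallel edges allowed). *)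
From mathcomp Require Import all_boot all_order all_algebra.
Set Implicit Arguments. Unset Strict Implicit. Unset Printing Implicit Defensive.

Section Graphs.
Variables (V E : finType) (ep : E -> V * V).

Definition joins (e : E) (x y : V) : bool := (ep e == (x, y)) || (ep e == (y, x)).

Definition adj (F : {set E}) (A : {set V}) : rel V :=
  fun x y => [&& x \in A, y \in A & [exists e in F, joins e x y]].

Definition incident (e : E) (v : V) : bool := ((ep e).1 == v) || ((ep e).2 == v).

Definition deg (F : {set E}) (v : V) : nat := #|[set e in F | incident e v]|.

Definition omega_del (S : {set V}) : nat :=
  #|[set [set y in ~: S | connect (adj [set: E] (~: S)) x y] | x in ~: S]|.

Definition iso_del (S : {set V}) : nat :=
  #|[set x in ~: S | [forall y, ~~ adj [set: E] (~: S) x y]]|.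

Definition sp_connected (T : {set E}) : bool :=
  [forall x, forall y, connect (adj T [set: V]) x y].

(* (V, T) is acyclic: no edge of T lies on a cycle, i.e. removing any edge e
   of T disconnects its two endpoints in (V, T \ e). *)
Definition acyclic (T : {set E}) : bool :=
  [forall e in T, ~~ connect (adj (T :\ e) [set: V]) (ep e).1 (ep e).2].

Definition spanning_tree (T : {set E}) : bool := sp_connected T && acyclic T.

Definition tree_connected (m : nat) (F : {set E}) : Prop :=
  exists T : 'I_m -> {set E},
    (forall i, T i \subset F) /\ (forall i, spanning_tree (T i)) /\
    (forall i j, i != j -> [disjoint T i & T j]).
End Graphs.

(* Main.v *)
(** The condition is used through the following consequence: for every [S] and every
    labelling of the vertices outside [S] with [p] labels and [q] edges joining different
    labels, [m p <= q + |S| + m].  One enlarges [S] until no such edge is left, so that only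
    components and isolated vertices matter.

    Call an edge set sparse if every nonempty [X] spans at most [m (|X| - 1)] of its edges, and
    call [X] tight in case of equality; tight sets are closed under intersecting unions.  A
    base is a sparse set for which all of [V] is tight; labelling vertices by maximal tight
    sets shows that bases exist.  Take a base [F] minimizing the total excess over the degree
    bounds.  If the excess is positive, a closure process builds a set [S] of vertices whose
    degrees are at least their bounds, containing an overfull vertex, such that each edge
    of the graph avoiding [S] is in [F] or lies in a tight set avoiding [S]; counting the edges
    of [F] around [S] contradicts the consequence above.

    Finally a base splits into [m] spanning trees (Nash-Williams): for a maximal partial
    partition into forests and an edge left over, the edges that can be left over after
    successive exchanges are spanned, in every class, by their own intersection with that
    class, which makes some vertex set violate sparsity. *)
Require Import Defs.
From mathcomp Require Import all_boot all_order all_algebra.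
From mathcomp Require Import zify ring.
Import GRing.Theory Num.Theory.
Set Implicit Arguments. Unset Strict Implicit. Unset Printing Implicit Defensive.

(** * Sparse edge sets, tight vertex sets and edge exchanges *)

Section SparseSets.
Variables (V E : finType) (ep : E -> V * V).
Implicit Types (F : {set E}) (X Y D S T : {set V}) (e f : E) (m : nat).

Definition ends e : {set V} := [set (ep e).1; (ep e).2].

Definition inside F X : {set E} := [set e in F | ends e \subset X].

Definition sparse m F : bool :=
  [forall X : {set V}, (X != set0) ==> (#|inside F X| + m <= m * #|X|)].

Definition tight m F X : bool :=
  (X != set0) && (#|inside F X| + m == m * #|X|).

Lemma ends_neq0 e : ends e != set0.
Proof. by apply/set0Pn; exists (ep e).1; rewrite set21. Qed.

Lemma sub_ends_neq0 e X : ends e \subset X -> X != set0.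
Proof. by apply: contraTneq => ->; rewrite subset0 ends_neq0. Qed.

Lemma incidentE e v : incident ep e v = (v \in ends e).
Proof. by rewrite /incident !inE ![v == _]eq_sym. Qed.

Lemma mem_inside F X e : (e \in inside F X) = (e \in F) && (ends e \subset X).
Proof. by rewrite inE. Qed.

Lemma inside_setT F : inside F setT = F.
Proof. by apply/setP=> e; rewrite inE subsetT andbT. Qed.

Lemma insideS F F' X : F \subset F' -> inside F X \subset inside F' X.
Proof.
by move=> /subsetP sFF'; apply/subsetP=> e; rewrite !inE => /andP[/sFF' -> ->].
Qed.

Lemma card_inside_supermod F X Y :
  #|inside F X| + #|inside F Y| <= #|inside F (X :|: Y)| + #|inside F (X :&: Y)|.
Proof.
rewrite -cardsUI; apply: leq_add; apply: subset_leq_card; apply/subsetP=> e.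
  rewrite !inE => /orP[] /andP[-> /subset_trans] -> //.
    exact: subsetUl.
  exact: subsetUr.
by rewrite !inE subsetI => /andP[/andP[-> ->] /andP[_ ->]].
Qed.

Lemma sparseP m F X : sparse m F -> X != set0 -> #|inside F X| + m <= m * #|X|.
Proof. by move=> /forallP/(_ X)/implyP. Qed.

Lemma sparseS m F F' : F \subset F' -> sparse m F' -> sparse m F.
Proof.
move=> sFF' spF'; apply/forallP=> X; apply/implyP=> X0.
apply: leq_trans (sparseP spF' X0); rewrite leq_add2r.
by apply/subset_leq_card/insideS.
Qed.

Lemma sparse0 m : sparse m set0.
Proof.
apply/forallP=> X; apply/implyP=> X0.
have ->: inside set0 X = set0 by apply/setP=> e; rewrite !inE.
by rewrite cards0 leq_pmulr // card_gt0.
Qed.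

Lemma tightP m F X : tight m F X -> #|inside F X| + m = m * #|X|.
Proof. by case/andP=> _ /eqP. Qed.

Lemma tight_neq0 m F X : tight m F X -> X != set0.
Proof. by case/andP. Qed.

Lemma tight1 m F x : sparse m F -> tight m F [set x].
Proof.
move=> spF; have x0 : [set x] != set0 by rewrite -card_gt0 cards1.
by have := sparseP spF x0; rewrite /tight x0 cards1; lia.
Qed.

(** Uncrossing: by supermodularity the union and the intersection together span at least as many
    edges as [X] and [Y], so neither sparsity bound can be strict. *)
Lemma tight_UI m F X Y : sparse m F -> tight m F X -> tight m F Y ->
  X :&: Y != set0 -> tight m F (X :|: Y) && tight m F (X :&: Y).
Proof.
move=> spF tX tY XY0.
have U0 : X :|: Y != set0.
  by apply: contra_neq (tight_neq0 tX) => XY; apply/eqP; rewrite -subset0 -XY subsetUl.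
have := sparseP spF XY0; have := sparseP spF U0.
have := card_inside_supermod F X Y; have := tightP tX; have := tightP tY.
have : m * #|X :|: Y| + m * #|X :&: Y| = m * #|X| + m * #|Y|.
  by rewrite -!mulnDr cardsUI.
by rewrite /tight U0 XY0 /=; lia.
Qed.

Lemma tightU m F X Y x : sparse m F -> tight m F X -> tight m F Y ->
  x \in X -> x \in Y -> tight m F (X :|: Y).
Proof.
move=> spF tX tY xX xY; have XY0 : X :&: Y != set0.
  by apply/set0Pn; exists x; rewrite inE xX.
by case/andP: (tight_UI spF tX tY XY0).
Qed.

Lemma card_inside_add F X e : e \notin F ->
  #|inside (e |: F) X| = #|inside F X| + (ends e \subset X).
Proof.
move=> eF; case: (boolP (ends e \subset X)) => eX.
  have -> : inside (e |: F) X = e |: inside F X.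
    by apply/setP=> f; rewrite !inE; case: eqP => [->|].
  by rewrite cardsU1 inE (negPf eF) addnC.
rewrite addn0; apply: eq_card => f; rewrite !inE.
by case: eqP => // ->; rewrite (negPf eX) !andbF.
Qed.

Lemma card_inside_del F X f : f \in F ->
  #|inside (F :\ f) X| + (ends f \subset X) = #|inside F X|.
Proof.
move=> fF; rewrite -[in RHS](setD1K fF) card_inside_add //.
by rewrite !inE eqxx.
Qed.

Lemma sparse_add m F e : sparse m F -> e \notin F ->
  (forall X, tight m F X -> ~~ (ends e \subset X)) -> sparse m (e |: F).
Proof.
move=> spF eF noX; apply/forallP=> X; apply/implyP=> X0.
have := noX X; rewrite card_inside_add // /tight X0 /=.
have := sparseP spF X0; case: (ends e \subset X); last by lia.
rewrite leq_eqVlt => /orP[-> //|]; first by move/(_ isT).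
by lia.
Qed.

(** Two tight sets spanning [e] share its ends, so their intersection is tight; one of minimum size
    is therefore the least. *)
Lemma min_tight m F e X : sparse m F -> tight m F X -> ends e \subset X ->
  exists T, [/\ tight m F T, ends e \subset T &
    forall Y, tight m F Y -> ends e \subset Y -> T \subset Y].
Proof.
move=> spF tX eX.
pose P Y := tight m F Y && (ends e \subset Y).
have PX : P X by rewrite /P tX.
case: (arg_minnP (fun Y : {set V} => #|Y|) PX) => T /andP[tT eT] minT.
exists T; split=> // Y tY eY.
have eTY : ends e \subset T :&: Y by rewrite subsetI eT.
case/andP: (tight_UI spF tT tY (sub_ends_neq0 eTY)) => _ tTY.
have := minT (T :&: Y); rewrite /P tTY eTY => /(_ isT) le.
have /eqP <- : T :&: Y == T by rewrite eqEcard subsetIl le.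
exact: subsetIr.
Qed.

(** Adding [e] breaks sparsity only at tight sets spanning [e], and only by one. Each of them
    contains [T], so deleting [f] repairs it: the edges inside [T] act as a fundamental circuit of
    [e]. *)
Lemma sparse_exchange m F e f T : sparse m F -> e \notin F ->
  (forall Y, tight m F Y -> ends e \subset Y -> T \subset Y) ->
  f \in inside F T -> sparse m (e |: F :\ f).
Proof.
move=> spF eF minT; rewrite inE => /andP[fF fT].
have eFf : e \notin F :\ f by rewrite !inE (negPf eF) andbF.
apply/forallP=> X; apply/implyP=> X0; rewrite card_inside_add //.
have := card_inside_del X fF; have := sparseP spF X0.
case: (boolP (ends e \subset X)) => eX; last by lia.
case: (boolP (tight m F X)) => [tX|]; last by rewrite /tight X0 /=; lia.
by rewrite (subset_trans fT (minT _ tX eX)); lia.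
Qed.

(** Inside [X] the new set has at most the edges of [F1] spanned by [X :|: D] but not by [D], plus
    those of [F2] spanned by [X :&: D]. The sparsity bounds for these two sets, minus the equality
    for [D], give the bound for [X]. *)
Lemma sparse_replace m F1 F2 D : sparse m F1 -> sparse m F2 -> tight m F1 D ->
  sparse m ((F1 :\: inside F1 D) :|: inside F2 D).
Proof.
move=> sp1 sp2 tD; apply/forallP=> X; apply/implyP=> X0.
case: (eqVneq (X :&: D) set0) => [XD0|XD0].
  apply: leq_trans (sparseP sp1 X0); rewrite leq_add2r.
  apply/subset_leq_card/subsetP=> e; rewrite !inE => /andP[/orP[/andP[_ ->] //|]].
  case/andP=> _ eD eX; move: (ends_neq0 e).
  have : ends e \subset X :&: D by rewrite subsetI eX.
  by rewrite XD0 subset0 => ->.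
have DX0 : X :|: D != set0.
  by apply: contra_neq X0 => XD; apply/eqP; rewrite -subset0 -XD subsetUl.
have h1 : #|inside ((F1 :\: inside F1 D) :|: inside F2 D) X|
          <= #|inside F1 (X :|: D) :\: inside F1 D| + #|inside F2 (X :&: D)|.
  rewrite -cardsUI; apply: leq_trans (leq_addr _ _).
  apply/subset_leq_card/subsetP=> e; rewrite !inE subsetI.
  case/andP=> /orP[/andP[nD eF]|/andP[-> ->]] eX; last by rewrite eX orbT.
  by rewrite nD eF (subset_trans eX (subsetUl _ _)).
have sDX : inside F1 D \subset inside F1 (X :|: D).
  by apply/subsetP=> e; rewrite !inE => /andP[-> /subset_trans ->] //; apply: subsetUr.
have := cardsD (inside F1 (X :|: D)) (inside F1 D); rewrite (setIidPr sDX) => h2.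
have := sparseP sp1 DX0; have := sparseP sp2 XD0; have := tightP tD.
have : m * #|X :|: D| + m * #|X :&: D| = m * #|X| + m * #|D|.
  by rewrite -!mulnDr cardsUI.
have := subset_leq_card sDX.
by lia.
Qed.

(* Otherwise the two sides of the cut would bound the edges of [X] by one [m] less. *)
Lemma tight_cut m F X Y : 0 < m -> sparse m F -> tight m F X ->
  X :&: Y != set0 -> ~~ (X \subset Y) ->
  exists2 e, e \in inside F X & ~~ (ends e \subset Y) && ~~ [disjoint ends e & Y].
Proof.
move=> m0 spF tX XY0 nXY; apply/exists_inP; apply: contraTT nXY => /exists_inPn noe.
rewrite negbK -setD_eq0; apply: contraTT tX => XD0.
have h : #|inside F X| <= #|inside F (X :&: Y)| + #|inside F (X :\: Y)|.
  rewrite -cardsUI; apply: leq_trans (leq_addr _ _).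
  apply/subset_leq_card/subsetP=> e eX; move: (noe e eX) (eX).
  rewrite !inE subsetI subsetD negb_and !negbK.
  by case/orP=> -> /andP[-> ->]; rewrite // orbT.
have := sparseP spF XY0; have := sparseP spF XD0.
have : m * #|X :&: Y| + m * #|X :\: Y| = m * #|X|.
  by rewrite -mulnDr cardsID.
by rewrite /tight; lia.
Qed.

End SparseSets.

(** * Maximal tight sets and the count of crossing edges *)

Section TightPartition.
Variables (V E : finType) (ep : E -> V * V).
Implicit Types (F : {set E}) (X Y D S T : {set V}) (e f : E) (m : nat).
Local Notation ends := (ends ep).
Local Notation inside := (inside ep).
Local Notation sparse := (sparse ep).
Local Notation tight := (tight ep).

Definition crossing (K : eqType) (c : V -> K) S : {set E} :=
  [set e | (ends e \subset ~: S) && (c (ep e).1 != c (ep e).2)].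

(** Maximality away from [S]: no edge of the graph avoiding [S] can be added to the edges of [F]
    avoiding [S] while keeping sparsity. *)
Definition saturated m F S : Prop := forall e, e \notin F -> [disjoint ends e & S] ->
  exists X, [/\ tight m F X, ends e \subset X & [disjoint X & S]].

Lemma disjointsU X Y S :
  [disjoint X :|: Y & S] = [disjoint X & S] && [disjoint Y & S].
Proof. by rewrite !disjoints_subset subUset. Qed.

Lemma ends_sub e X : (ends e \subset X) = ((ep e).1 \in X) && ((ep e).2 \in X).
Proof. by rewrite subUset !sub1set. Qed.

(** Singletons are tight and intersecting tight sets have a tight union, so the maximal tight sets
    avoiding [S] partition the complement of [S]; [c x] is the block of [x]. *)
Lemma tight_partition m F S : sparse m F ->
  exists c : V -> {set V},
    [/\ forall x, x \notin S -> [/\ tight m F (c x), [disjoint c x & S] & x \in c x],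
        forall x X, x \in X -> tight m F X -> [disjoint X & S] -> X \subset c x
      & forall x y, x \notin S -> y \notin S -> (c y == c x) = (y \in c x)].
Proof.
move=> spF.
pose P x X := [&& tight m F X, [disjoint X & S] & x \in X].
(* For [x] in [S] no set satisfies [P x], and the default [[set x]] is a junk value. *)
pose c x : {set V} := [arg max_(X > [set x] | P x X) #|X|].
have P1 x : x \notin S -> P x [set x].
  by move=> xS; rewrite /P tight1 // disjoints1 xS set11.
have cP x : x \notin S -> P x (c x).
  by move=> xS; rewrite /c; case: arg_maxnP => //; apply: P1.
have cmax x X : x \in X -> tight m F X -> [disjoint X & S] -> X \subset c x.
  move=> xX tX dX; have xS : x \notin S by rewrite (disjointFr dX xX).
  rewrite /c; case: arg_maxnP => [|Y /and3P[tY dY xY] maxY]; first exact: P1.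
  have PXY : P x (Y :|: X).
    by rewrite /P (tightU spF tY tX xY xX) disjointsU dX dY inE xX orbT.
  suff /eqP -> : Y == Y :|: X by apply: subsetUr.
  by rewrite eqEcard subsetUl; apply: maxY.
exists c; split=> // [x /cP/and3P[]|x y xS yS] //.
have /and3P[tx dx xx] := cP _ xS; have /and3P[ty dy yy] := cP _ yS.
apply/eqP/idP=> [<- //|yx].
have s1 := cmax y _ yx tx dx; apply/eqP; rewrite eqEsubset s1 andbT.
by apply: cmax ty dy; apply: (subsetP s1).
Qed.

(** Label each vertex by its block. The edges of [F] avoiding [S] are those inside blocks,
    [m * #|A| - m] for each block [A], and the crossing ones; by saturation every crossing edge of
    the graph belongs to [F]. *)
Lemma saturated_count m F S : sparse m F -> saturated m F S ->
  exists c : V -> {set V},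
    m * #|c @: ~: S| + #|inside F (~: S)| = m * #|~: S| + #|crossing c S|.
Proof.
move=> spF satF; have [c [cP cmax cE]] := tight_partition S spF.
exists c.
have cE' A x : x \notin S -> A = c x -> (fun y => (y \in ~: S) && (c y == A)) =1 mem A.
  move=> xS -> y /=; rewrite inE; case: (boolP (y \in S)) => yS /=; last by rewrite cE.
  by case: (cP _ xS) => _ dx _; rewrite (disjointFl dx yS).
have cV : #|~: S| = \sum_(A in c @: ~: S) #|A|.
  rewrite -sum1_card (partition_big_imset c) /=.
  apply: eq_bigr => A /imsetP[x]; rewrite inE => xS AE.
  by rewrite -sum1_card; apply: eq_bigl; apply: cE' AE.
(* A crossing edge outside [F] would lie in a tight set avoiding [S], hence within one block. *)
have sC : crossing c S \subset inside F (~: S).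
  apply/subsetP=> e; rewrite !inE => /andP[eS ne]; rewrite eS andbT.
  apply: contraR ne => eF; have [] := satF e eF.
    by rewrite disjoints_subset.
  move=> X [tX eX dX]; move: eX eS; rewrite !ends_sub !in_setC => /andP[x1 x2] /andP[s1 s2].
  by rewrite cE //; apply: (subsetP (cmax _ _ x2 tX dX)).
have cF : #|inside F (~: S) :\: crossing c S| = \sum_(A in c @: ~: S) #|inside F A|.
  rewrite -sum1_card.
  rewrite (partition_big (fun e => c (ep e).1) (mem (c @: ~: S))) /=; last first.
    move=> e; rewrite !inE ends_sub => /and3P[_ _ /andP[e1 _]].
    by apply: imset_f.
  apply: eq_bigr => A /imsetP[x]; rewrite inE => xS AE; rewrite -sum1_card.
  apply: eq_bigl => e; rewrite !inE !ends_sub !in_setC AE.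
  have inS y : y \in c x -> y \notin S.
    by case: (cP _ xS) => _ dx _ /(disjointFr dx) ->.
  case: (boolP ((ep e).1 \in c x)) => e1.
    have s1 := inS _ e1; have -> : c (ep e).1 = c x by apply/eqP; rewrite cE.
    rewrite s1 eqxx andbT /=; case: (boolP ((ep e).2 \in c x)) => e2.
      have s2 := inS _ e2; have -> : c (ep e).2 = c x by apply/eqP; rewrite cE.
      by rewrite s2 eqxx !andbT.
    rewrite andbF; case: (boolP ((ep e).2 \in S)) => s2; first by rewrite !andbF.
    by rewrite eq_sym cE // e2.
  rewrite !andbF; case: (boolP ((ep e).1 \in S)) => s1; first by rewrite !andbF.
  by rewrite (cE x) // (negPf e1) !andbF.
have cFC : #|inside F (~: S)| = #|crossing c S| + \sum_(A in c @: ~: S) #|inside F A|.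
  by rewrite -cF -(cardsID (crossing c S) (inside F (~: S))) (setIidPr sC).
have : \sum_(A in c @: ~: S) (#|inside F A| + m) = \sum_(A in c @: ~: S) m * #|A|.
  apply: eq_bigr => A /imsetP[x]; rewrite inE => /cP[tx _ _] ->.
  exact: tightP tx.
rewrite big_split /= sum_nat_const -big_distrr /= -cV (mulnC #|_| m) cFC => <-.
by rewrite addnCA addnC (addnC (m * _)).
Qed.

Lemma exists_saturated m : exists2 F, sparse m F & saturated m F set0.
Proof.
case: (arg_maxnP (fun F : {set E} => #|F|) (sparse0 ep m)) => F spF maxF.
exists F => // e eF _.
case: (boolP [exists X : {set V}, tight m F X && (ends e \subset X)]).
  by case/existsP=> X /andP[tX eX]; exists X; split=> //; rewrite disjoint_sym -setI_eq0 set0I.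
move=> /existsPn noX; have := maxF (e |: F); rewrite /= cardsU1 eF ltnn => abs.
suff /abs : sparse m (e |: F) by []; apply: sparse_add => // X tX.
by have := noX X; rewrite tX.
Qed.

End TightPartition.

(** * Bases, local rearrangements and the blocking set *)

Section DegreeExchange.
Variables (V E : finType) (ep : E -> V * V).
Implicit Types (F : {set E}) (W X Y D S T : {set V}) (e f : E) (m : nat) (x y v : V).
Local Notation ends := (ends ep).
Local Notation inside := (inside ep).
Local Notation sparse := (sparse ep).
Local Notation tight := (tight ep).
Local Notation deg := (deg ep).

Definition base m F : bool := sparse m F && (#|F| + m == m * #|V|).

Definition agree_outside F F' D : bool :=
  [forall e, (ends e \subset D) || ((e \in F') == (e \in F))].

Lemma agreeP F F' D e : agree_outside F F' D -> ~~ (ends e \subset D) ->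
  (e \in F') = (e \in F).
Proof. by move=> /forallP/(_ e)/orP[->|/eqP]. Qed.

(** Bases have equal size, so agreement outside [X] forces equal counts inside. Hence supersets of
    [D] are tight for both bases or for neither. *)
Lemma agree_card_inside m F F' D X : base m F -> base m F' ->
  agree_outside F F' D -> D \subset X -> #|inside F' X| = #|inside F X|.
Proof.
move=> /andP[_ /eqP cF] /andP[_ /eqP cF'] agr sDX.
have : F' :\: inside F' X = F :\: inside F X.
  apply/setP=> e; rewrite !inE; case: (boolP (ends e \subset X)) => eX.
    by rewrite !andbT !andNb.
  rewrite !andbF /=; apply: agreeP agr _.
  by apply: contra eX => /subset_trans; apply.
move/(congr1 (fun A : {set E} => #|A|)).
have := cardsID (inside F' X) F'; have := cardsID (inside F X) F.
have sI A : A :&: inside A X = inside A X.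
  by apply/setIidPr/subsetP=> e; rewrite inE => /andP[].
by rewrite !sI; lia.
Qed.

Lemma deg_exchange F e f v : e \notin F -> f \in F ->
  deg (e |: F :\ f) v + (v \in ends f) = deg F v + (v \in ends e).
Proof.
move=> eF fF.
have degE A : deg A v = #|[set a in A | v \in ends a]|.
  by apply: eq_card => a; rewrite [LHS]in_set [RHS]in_set incidentE.
have addE (A : {set E}) a : a \notin A ->
    #|[set b in a |: A | v \in ends b]| = #|[set b in A | v \in ends b]| + (v \in ends a).
  move=> aA; case: (boolP (v \in ends a)) => va.
    have -> : [set b in a |: A | v \in ends b] = a |: [set b in A | v \in ends b].
      apply/setP=> b; rewrite [LHS]in_set !(in_setU1 b a) [b \in [set _ in A | _]]in_set.
      by case: eqP => [->|//]; rewrite va.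
    by rewrite cardsU1 in_set (negPf aA) addnC.
  rewrite addn0; apply: eq_card => b; rewrite [LHS]in_set [RHS]in_set in_setU1.
  by case: eqP => // ->; rewrite (negPf va) !andbF.
rewrite !degE addE; last by rewrite !inE (negPf eF) andbF.
by rewrite -[in RHS](setD1K fF) addE ?inE ?eqxx // addnAC.
Qed.

Lemma base_setT m F x : base m F -> tight m F [set: V].
Proof.
case/andP=> _ cF; rewrite /tight inside_setT cardsT cF andbT.
by apply/set0Pn; exists x; rewrite inE.
Qed.

Definition reducible m F (g : V -> nat) W v : bool :=
  [exists D : {set V}, [exists F' : {set E},
    [&& [&& tight m F D, v \in D & [disjoint D & W]],
        base m F', agree_outside F F' D,
        [forall w, deg F' w <= g w] & deg F' v < g v]]].

Definition blocked m F g W : {set V} := [set v | ~~ reducible m F g W v].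

Lemma reducibleP m F g W v : reducible m F g W v ->
  exists D F', [/\ [/\ tight m F D, v \in D & [disjoint D & W]],
     base m F', agree_outside F F' D, (forall w, deg F' w <= g w) & deg F' v < g v].
Proof.
case/existsP=> D /existsP[F' /and5P[/and3P[a b c] d e /forallP f h]].
by exists D, F'.
Qed.

Lemma blocked_homo m F g : {homo blocked m F g : W W' / W \subset W'}.
Proof.
move=> W W' sWW'; apply/subsetP=> v; rewrite !inE; apply: contra.
case/existsP=> D /existsP[F' /andP[/and3P[a b c] d]].
apply/existsP; exists D; apply/existsP; exists F'; rewrite d a b !andbT /=.
by rewrite disjoint_sym; apply: disjointWl sWW' _; rewrite disjoint_sym.
Qed.

(** [F'] takes the edges spanned by [D1] from [F1] and all others from [F2]. Since [F2] agrees with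
    [F] inside [D1], the set [D1] is tight for [F2] and the replacement stays sparse. *)
Lemma base_merge m F F1 F2 D1 D2 : base m F -> base m F1 -> base m F2 ->
  agree_outside F F1 D1 -> agree_outside F F2 D2 -> tight m F D1 -> tight m F D2 ->
  [disjoint D1 & D2] ->
  exists F', [/\ base m F', tight m F' D1 && tight m F' D2,
    forall e, ~~ (ends e \subset D1) -> ~~ (ends e \subset D2) -> (e \in F') = (e \in F),
    forall v, v \in D1 -> deg F' v = deg F1 v &
    forall v, v \notin D1 -> deg F' v = deg F2 v].
Proof.
move=> bF bF1 bF2 a1 a2 t1 t2 d12.
have eq21 : inside F2 D1 = inside F D1.
  apply/setP=> e; rewrite !inE; case: (boolP (ends e \subset D1)) => e1; rewrite ?andbF //.
  rewrite !andbT; apply: agreeP a2 _; move: e1; rewrite !ends_sub => /andP[e1 _].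
  by rewrite (disjointFr d12 e1).
pose F' := (F2 :\: inside F2 D1) :|: inside F1 D1.
have F'E e : (e \in F') = if ends e \subset D1 then e \in F1 else e \in F2.
  by rewrite !inE; case: ifP => _; rewrite ?andbT ?andbF ?orbF ?andNb.
case/andP: (bF1) => sp1 c1; case/andP: (bF2) => sp2 c2.
have t21 : tight m F2 D1 by rewrite /tight eq21.
exists F'; split.
- rewrite /base sparse_replace //= /F'.
  have -> : #|F2 :\: inside F2 D1 :|: inside F1 D1| =
      #|F2 :\: inside F2 D1| + #|inside F1 D1|.
    rewrite cardsU -[RHS]subn0; congr (_ - _); apply/eqP; rewrite cards_eq0.
    by apply/eqP/setP=> e; rewrite !inE; case: (ends e \subset D1); rewrite ?andbF // !andbT andNb.
  rewrite (agree_card_inside bF bF1 a1) // -eq21.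
  have := cardsID (inside F2 D1) F2.
  have -> : F2 :&: inside F2 D1 = inside F2 D1.
    by apply/setIidPr/subsetP=> e; rewrite inE => /andP[].
  by rewrite addnC => ->.
- have -> : tight m F' D1 = tight m F D1.
    rewrite /tight -(agree_card_inside bF bF1 a1 (subxx _)); congr (_ && (#|pred_of_set _| + m == _)).
    by apply/setP=> e; rewrite !mem_inside F'E; case: ifP; rewrite ?andbF.
  rewrite t1 /= /tight.
  have -> : inside F' D2 = inside F2 D2.
    apply/setP=> e; rewrite !mem_inside F'E; case: ifP => // e1.
    suff /negPf -> : ~~ (ends e \subset D2) by rewrite !andbF.
    move: e1; rewrite !ends_sub => /andP[e1 _].
    by rewrite (disjointFr d12 e1).
  by rewrite (agree_card_inside bF bF2 a2 (subxx _)).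
- by move=> e e1 e2; rewrite F'E (negPf e1); apply: agreeP a2 e2.
- move=> v v1; apply: eq_card => e; rewrite [LHS]in_set [RHS]in_set incidentE.
  case: (boolP (v \in ends e)) => ve; rewrite ?andbF // !andbT F'E.
  case: ifPn => // e1; rewrite (agreeP a1 e1); apply: agreeP a2 _.
  by apply: contraL v1 => /subsetP/(_ _ ve) v2; rewrite (disjointFl d12 v2).
move=> v v1; apply: eq_card => e; rewrite [LHS]in_set [RHS]in_set incidentE.
case: (boolP (v \in ends e)) => ve; rewrite ?andbF // !andbT F'E.
by case: ifPn => // /subsetP/(_ _ ve); rewrite (negPf v1).
Qed.

(* Rearranging [F] inside [D1] and [D2] leaves room for one more edge at both ends of [e].  If
   the minimal tight set of [e] then met the blocked set at [z], exchanging [e] for an edge at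
   [z] would make [z] reducible. *)
Lemma tight_avoid_blocked m F g S W D e : 0 < m -> base m F ->
  e \notin F -> reducible m F g S (ep e).1 -> reducible m F g S (ep e).2 ->
  W \subset S -> blocked m F g W \subset S ->
  tight m F D -> ends e \subset D -> [disjoint D & W] ->
  exists X, [/\ tight m F X, ends e \subset X & [disjoint X & blocked m F g W]].
Proof.
move=> m0 bF eF; set x := (ep e).1; set y := (ep e).2.
case/reducibleP=> D1 [F1 [[t1 x1 d1] b1 a1 g1 lt1]].
case/reducibleP=> D2 [F2 [[t2 y2 d2] b2 a2 g2 lt2]] sWS sBS tD eD dD.
set B := blocked m F g W in sBS *.
have spF : sparse m F by case/andP: bF.
have disjS X : X \subset S -> forall Y, [disjoint Y & S] -> [disjoint Y & X].
  by move=> sX Y; rewrite !(disjoint_sym Y); apply: disjointWl.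
have [xe ye] : x \in ends e /\ y \in ends e by rewrite set21 set22.
have xD := subsetP eD _ xe; have yD := subsetP eD _ ye.
case: (boolP [exists X : {set V},
    [&& tight m F X, ends e \subset X & [disjoint X & B]]]).
  by case/existsP=> X /and3P[]; exists X.
move=> /existsPn noX; exfalso.
(* If they met, their union would be a tight set spanning [e] and avoiding [S], hence avoiding
   [B]. *)
have dD12 : [disjoint D1 & D2].
  apply/pred0P=> z /=; apply/negP=> /andP[z1 z2].
  have := noX (D1 :|: D2); rewrite (tightU spF t1 t2 z1 z2) ends_sub !in_setU x1 y2 orbT /=.
  by rewrite disjointsU !(disjS _ sBS).
have [F' [bF' /andP[t1' t2'] memF' deg1 deg2]] := base_merge bF b1 b2 a1 a2 t1 t2 dD12.
have aF' : agree_outside F F' (D1 :|: D2).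
  apply/forallP=> a; case: (boolP (ends a \subset _)) => //= aU; apply/eqP.
  by apply: memF'; apply: contra aU => /subset_trans ->; rewrite ?subsetUl ?subsetUr.
have spF' : sparse m F' by case/andP: bF'.
have y1 : y \notin D1 by rewrite (disjointFl dD12 y2).
have x2 : x \notin D2 by rewrite (disjointFr dD12 x1).
have tD' : tight m F (D :|: (D1 :|: D2)).
  rewrite setUA; apply: (@tightU _ _ _ _ _ _ _ y) => //; last by rewrite inE yD.
  exact: tightU xD x1.
have tF' X : D1 :|: D2 \subset X -> tight m F' X = tight m F X.
  by move=> sX; rewrite /tight (agree_card_inside bF bF' aF' sX).
have tD'' : tight m F' (D :|: (D1 :|: D2)) by rewrite tF' ?subsetUr.
have eD' : ends e \subset D :|: (D1 :|: D2) by apply: subset_trans eD (subsetUl _ _).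
have [T [tT eT minT]] := min_tight spF' tD'' eD'.
have sTD := minT _ tD'' eD'.
have eF' : e \notin F'.
  by rewrite memF' // ends_sub negb_and ?y1 ?x2 ?orbT.
(* [T] is tight for [F'], perhaps not for [F]; joining [D1] and [D2], outside which the two bases
   agree, gives a set tight for both. It meets [B], and it can do so only in [T], because [D1] and
   [D2] avoid [B]. *)
pose X := T :|: (D1 :|: D2).
have tX : tight m F X.
  rewrite -tF' ?subsetUr // /X setUA.
  apply: (tightU spF' _ t2' _ y2); last by rewrite in_setU (subsetP eT _ ye).
  exact: tightU (subsetP eT _ xe) x1.
have eX : ends e \subset X by apply: subset_trans eT (subsetUl _ _).
have := noX X; rewrite tX eX /= => /pred0Pn[z /andP[/= zX zB]].
have [z1 z2] : z \notin D1 /\ z \notin D2.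
  by rewrite (disjointFl (disjS _ sBS _ d1) zB) (disjointFl (disjS _ sBS _ d2) zB).
have zT : z \in T by move: zX; rewrite !in_setU (negPf z1) (negPf z2) !orbF.
have ze : z \notin ends e.
  rewrite in_set2; apply/norP; split; apply/negP=> /eqP ez.
    by rewrite ez x1 in z1.
  by rewrite ez y2 in z2.
(* The edge comes from cutting the tight set [T] at [[set z]], a proper part of [T] since [x] is
   another vertex of it. *)
have [f fT fz] : exists2 f, f \in inside F' T & z \in ends f.
  have [||f fT /andP[_]] := @tight_cut _ _ _ m F' T [set z] m0 spF' tT.
  - by apply/set0Pn; exists z; rewrite !inE zT eqxx.
  - apply/negP=> /subsetP/(_ _ (subsetP eT _ xe)); rewrite inE => /eqP xz.
    by rewrite -xz xe in ze.
  by rewrite disjoint_sym disjoints1 negbK; exists f.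
have fF' : f \in F' by move: fT; rewrite mem_inside => /andP[].
have fD : ends f \subset D :|: (D1 :|: D2).
  by move: fT; rewrite mem_inside => /andP[_ /subset_trans]; apply.
pose F'' := e |: F' :\ f.
have degF'' v := deg_exchange v eF' fF'.
have leF' v : deg F' v <= g v.
  have := deg1 v; have := deg2 v; case: (boolP (v \in D1)) => v1; last by move=> ->.
  by move=> _ ->.
have ltx : deg F' x < g x by rewrite deg1.
have lty : deg F' y < g y by rewrite deg2.
have degz : deg F'' z < g z.
  have := degF'' z; rewrite fz (negPf ze) addn0 addn1 => dz.
  by rewrite /F'' dz leF'.
move: zB; rewrite inE => /negP; apply.
apply/existsP; exists (D :|: (D1 :|: D2)); apply/existsP; exists F''.
rewrite tD' (subsetP sTD _ zT); apply/and5P; split => //.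
- by rewrite !disjointsU dD !(disjS _ sWS).
- rewrite /base (sparse_exchange spF' eF' minT fT) /=.
  case/andP: bF' => _ /eqP <-.
  by rewrite cardsU1 !inE (negPf eF') andbF (cardsD1 f F') fF'.
- apply/forallP=> a; case: (boolP (ends a \subset _)) => //= aD; apply/eqP.
  rewrite -(agreeP aF'); last by apply: contra aD => /subset_trans -> //; apply: subsetUr.
  rewrite in_setU1 in_setD1; case: eqP => [ae|_]; first by rewrite ae eD' in aD.
  by case: eqP => [af|//]; rewrite af fD in aD.
(* Only the ends of [e] can gain degree, by one, and both have slack in [F']. *)
apply/forallP=> v; have := leq_addr (v \in ends f) (deg F'' v).
rewrite {2}/F'' degF'' => /leq_trans; apply.
case: (boolP (v \in ends e)) => ve; last by rewrite addn0.
by rewrite addn1; move: ve; rewrite in_set2 => /orP[]/eqP ->.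
Qed.

(** A vertex with slack in [F] is reducible through the tight set [[set v]] and [F] itself, so it
    never enters the iteration. *)
Lemma iter_blocked_deg m F g k v : base m F -> (forall w, deg F w <= g w) ->
  v \in iter k (blocked m F g) set0 -> g v <= deg F v.
Proof.
move=> bF leF; elim: k v => [|k IHk] v /=; first by rewrite inE.
case: (boolP (v \in iter k (blocked m F g) set0)) => [/IHk //|vk].
rewrite inE leqNgt; apply: contra => ltv.
apply/existsP; exists [set v]; apply/existsP; exists F.
rewrite tight1 ?disjoints1 ?set11 ?vk ?bF ?ltv ?andbT /=; last by case/andP: bF.
by apply/andP; split; apply/forallP=> // e; rewrite eqxx orbT.
Qed.

(** The set is the least fixed point of [blocked]. An edge outside [F] avoiding it has two reducible
    ends; starting from the tight set of all vertices, one finds for each iterate a tight set that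
    spans the edge and avoids the iterate. *)
Lemma blocking_set m F g : 0 < m -> base m F -> (forall w, deg F w <= g w) ->
  exists S, [/\ forall v, v \in S -> g v <= deg F v,
    forall v, (forall F', base m F' -> (forall w, deg F' w <= g w) -> g v <= deg F' v) ->
      v \in S & saturated ep m F S].
Proof.
move=> m0 bF leF; set Phi := blocked m F g.
have homoP : {homo Phi : W W' / W \subset W'} := @blocked_homo m F g.
have fixS : Phi (fixset Phi) = fixset Phi := fixsetK homoP.
exists (fixset Phi); split.
- by move=> v; apply: iter_blocked_deg.
- move=> v minv; rewrite -fixS inE; apply/negP=> /reducibleP[D [F' [_ bF' _ le' lt']]].
  by have := minv _ bF' le'; rewrite leqNgt lt'.
move=> e eF; rewrite disjoints_subset ends_sub !in_setC -[in X in X -> _]fixS.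
rewrite !in_set !negbK => /andP[r1 r2].
(* The least fixed point is by definition the iterate number [#|V|] from the empty set. *)
suff /(_ #|V|) : forall k, exists X,
  [/\ tight m F X, ends e \subset X & [disjoint X & iter k Phi set0]] by [].
elim=> [|k [D [tD eD dD]]] /=.
  exists [set: V]; split; rewrite ?subsetT //; first exact: base_setT (ep e).1 bF.
  by rewrite disjoint_sym -setI_eq0 set0I.
apply: tight_avoid_blocked r1 r2 _ _ tD eD dD => //.
  exact: iter_sub_fix.
exact: (@iter_sub_fix _ _ homoP k.+1).
Qed.

(* A base minimizing the total excess over [h] has all its overfull vertices in its
   blocking set. *)
Lemma base_deg_bounded m F0 (h : V -> nat) : 0 < m -> base m F0 ->
  (forall F S, base m F -> saturated ep m F S -> S != set0 ->
    \sum_(v in S) deg F v <= \sum_(v in S) h v) ->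
  exists2 F, base m F & forall v, deg F v <= h v.
Proof.
move=> m0 bF0 sumS.
case: (arg_minnP (fun F : {set E} => \sum_v (deg F v - h v)) bF0) => F bF minF.
exists F => // v0; rewrite leqNgt; apply/negP=> lt0.
(* With this bound [F] itself is feasible and no feasible base has larger excess at any vertex; one
   with smaller degree at [v0] would have smaller total excess. *)
have [S [degS inS satS]] := @blocking_set m F (fun v => maxn (h v) (deg F v)) m0 bF
  (fun v => leq_maxr _ _).
have v0S : v0 \in S.
  apply: inS => F' bF' leF'; rewrite leqNgt; apply/negP=> lt'.
  have := minF _ bF'; rewrite /= leqNgt => /negP; apply.
  rewrite (bigD1 v0) //= [X in _ < X](bigD1 v0) //= -addSn; apply: leq_add.
    by move: lt'; lia.
  by apply: leq_sum => v _; have := leF' v; lia.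
have := sumS F S bF satS; rewrite leqNgt.
have -> : S != set0 by apply/set0Pn; exists v0.
move=> /(_ isT)/negP; apply.
rewrite (bigD1 v0) //= [X in _ < X](bigD1 v0) //= -addSn; apply: leq_add => //.
by apply: leq_sum => v /andP[vS _]; have := degS v vS; lia.
Qed.

End DegreeExchange.

(** * From components and isolated vertices to arbitrary labellings *)

Section ComponentBound.
Variables (V E : finType) (ep : E -> V * V).
Hypothesis noloop : forall e, (ep e).1 != (ep e).2.
Implicit Types (F : {set E}) (W X Y D S T : {set V}) (e f : E) (m : nat) (x y v w : V).
Local Notation ends := (ends ep).
Local Notation inside := (inside ep).
Local Notation deg := (deg ep).
Local Notation crossing := (crossing ep).
Local Notation adjS S := (adj ep [set: E] (~: S)).

Lemma sum_incidence F X :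
  \sum_(v in X) #|[set e in F | v \in ends e]| = \sum_(e in F) #|ends e :&: X|.
Proof.
transitivity (\sum_(v in X) \sum_(e in F) (v \in ends e)).
  apply: eq_bigr => v _; rewrite -sum1_card big_mkcond [RHS]big_mkcond.
  by apply: eq_bigr => e _; rewrite in_set; case: (e \in F); case: (v \in ends e).
rewrite exchange_big; apply: eq_bigr => e _.
rewrite -sum1_card big_mkcond [RHS]big_mkcond.
by apply: eq_bigr => v _; rewrite in_setI; case: (v \in X); case: (v \in ends e).
Qed.

Lemma card_endsI e X : #|ends e :&: X| <= 1 + (ends e \subset X).
Proof.
case: (boolP (ends e \subset X)) => eX.
  by apply: leq_trans (subset_leq_card (subsetIl _ _)) _; rewrite cards2; case: (_ != _).
rewrite addn0 -ltnS; have : ends e :&: X \proper ends e.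
  by rewrite properE subsetIl subsetI subxx.
by move/proper_card/leq_trans; apply; rewrite cards2; case: (_ != _).
Qed.

(** An edge avoiding [S] is counted once on the left by the first term, an edge with one end in [S]
    once by the degrees, and an edge inside [S] twice. *)
Lemma sum_deg_le F S :
  #|inside F (~: S)| + \sum_(v in S) deg F v <= #|F| + #|inside F S|.
Proof.
have insE X : #|inside F X| = \sum_(e in F) (ends e \subset X).
  rewrite -sum1_card big_mkcond [RHS]big_mkcond.
  by apply: eq_bigr => e _; rewrite in_set; case: (e \in F); case: (ends e \subset X).
have -> : \sum_(v in S) deg F v = \sum_(e in F) #|ends e :&: S|.
  rewrite -sum_incidence; apply: eq_bigr => v _.
  by apply: eq_card => e; rewrite [LHS]in_set [RHS]in_set incidentE.
rewrite !insE -sum1_card -!big_split /=; apply: leq_sum => e _.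
case: (boolP (ends e \subset ~: S)) => eS; last exact: card_endsI.
suff -> : ends e :&: S = set0 by rewrite cards0.
by apply/eqP; rewrite setI_eq0 disjoints_subset.
Qed.

Definition other v e := if (ep e).1 == v then (ep e).2 else (ep e).1.

Lemma adj_edge X x y : adj ep [set: E] X x y ->
  exists e, [/\ x \in ends e, other x e = y, ends e \subset X & y != x].
Proof.
case/and3P=> xX yX /exists_inP[e _]; rewrite /joins => /orP[]/eqP epe; exists e;
  move: (noloop e); rewrite ends_sub in_set2 /other epe /= ?eqxx ?orbT xX yX.
  by rewrite eq_sym.
by move=> /negPf->.
Qed.

Lemma edge_adj X x e : ends e \subset X -> x \in ends e ->
  adj ep [set: E] X x (other x e) && (other x e \in ends e).
Proof.
move=> eX xe; have oe : other x e \in ends e.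
  by rewrite /other; case: ifP => _; rewrite ?set21 ?set22.
rewrite /adj (subsetP eX _ xe) (subsetP eX _ oe) oe andbT /=.
apply/exists_inP; exists e => //; rewrite /joins /other.
move: xe; rewrite in_set2 => /orP[]/eqP->; first by rewrite eqxx -surjective_pairing eqxx.
by rewrite (negPf (noloop e)) -surjective_pairing eqxx orbT.
Qed.

Lemma adjC X x y : adj ep [set: E] X x y = adj ep [set: E] X y x.
Proof.
rewrite /adj andbCA; do 2!congr (_ && _); apply: eq_existsb => e.
by rewrite /joins orbC.
Qed.

Variable m : nat.
(** The condition of the theorem multiplied by [2 * m]. *)
Hypothesis component_bound : forall S,
  m * m.+1 * iso_del ep S + 2 * m * omega_del ep S <= 2 * #|S| + 2 * m.

(** Without crossing edges labels are constant on components, so reading off the label of a chosen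
    vertex maps components onto labels. *)
Lemma card_labels_omega (K : finType) (c : V -> K) S : crossing c S = set0 ->
  #|c @: ~: S| <= omega_del ep S.
Proof.
move=> cr0; case: (set_0Vmem (~: S)) => [->|[x0 x0S]]; first by rewrite imset0 cards0.
pose h (A : {set V}) := c (odflt x0 [pick x in A]).
pose A x := [set y in ~: S | connect (adjS S) x y].
rewrite [omega_del ep S](_ : _ = #|A @: ~: S|) //.
apply: leq_trans (leq_imset_card h _).
apply/subset_leq_card/subsetP=> k /imsetP[x xS ->].
suff <- : h (A x) = c x by do 2!apply: imset_f.
rewrite /h.
case: pickP => [y|/(_ x)] /=; last by rewrite inE xS connect0.
rewrite inE => /andP[_ /connectP[p]]; elim: p x xS => [x _ _ -> //|z p IHp x xS] /=.
case/andP=> xz pz lz; rewrite (IHp z _ pz lz); last by case/and3P: xz.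
have [e [xe <- eS _]] := adj_edge xz.
apply/eqP; apply: contraT => ne; have : e \in crossing c S; last by rewrite cr0 inE.
rewrite inE eS; move: xe ne; rewrite in_set2 => /orP[]/eqP->; rewrite /other.
  by rewrite eqxx eq_sym.
by rewrite (negPf (noloop e)).
Qed.

(* Adding to [S] a vertex that has a crossing edge and shares its label costs nothing.  Once
   all crossing edges join vertices with unshared labels, deleting the [k] neighbours of such
   a vertex of minimum degree isolates it and removes at least [k (k + 1) / 2] crossing edges;
   the balance is [(k - m) (k - m - 1) >= 0]. *)
Lemma labelling_bound (K : finType) (c : V -> K) S :
  m * m.+1 * iso_del ep S + 2 * m * #|c @: ~: S|
    <= 2 * #|crossing c S| + 2 * #|S| + 2 * m.
(* Induction on the number of vertices outside [S]. The isolated term is kept because the newly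
   isolated vertex pays for the labels lost. *)
Proof.
have [n] := ubnP #|~: S|; elim: n S => // n IHn S; rewrite ltnS => leS.
case: (eqVneq (crossing c S) set0) => [cr0|crN0].
  rewrite cr0 cards0 muln0 add0n; apply: leq_trans (component_bound S).
  by rewrite leq_add2l leq_mul2l card_labels_omega ?orbT.
have crE e : e \in crossing c S -> ends e \subset ~: S by rewrite inE => /andP[].
have delS X : X \subset ~: S -> X != set0 -> #|~: (S :|: X)| < n.
  move=> sX X0; apply: leq_trans leS; apply: proper_card; rewrite properE setCU subsetIl /=.
  case/set0Pn: X0 => x xX; apply/subsetPn; exists x; first exact: (subsetP sX).
  by rewrite in_setI !in_setC xX andbF.
have isoP x X : x \in [set x in ~: S | [forall y, ~~ adjS S x y]] -> x \notin X ->
    x \in [set x in ~: (S :|: X) | [forall y, ~~ adjS (S :|: X) x y]].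
  rewrite !inE negb_or => /andP[-> /forallP nx] ->; apply/forallP=> y.
  apply: contra (nx y) => /and3P[]; rewrite /adj !in_setC !in_setU !negb_or.
  by move=> /andP[-> _] /andP[-> _] ->.
have cr_sub X : crossing c (S :|: X) \subset [set e in crossing c S | ends e \subset ~: X].
  by apply/subsetP=> e; rewrite !in_set setCU subsetI -andbA => /and3P[-> -> ->].
case: (boolP [exists v, [exists e in crossing c S, (v \in ends e) &&
    [exists w, [&& w \in ~: S, w != v & c w == c v]]]]).
  case/existsP=> v /exists_inP[e ecr /andP[ve /existsP[w /and3P[wS wv /eqP cw]]]].
  have vS := subsetP (crE _ ecr) _ ve.
  have := IHn (S :|: [set v]) (delS _ _ _); rewrite sub1set vS => /(_ isT).
  rewrite -card_gt0 cards1 => /(_ isT).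
  have -> : c @: (~: (S :|: [set v])) = c @: (~: S).
    apply/setP/subset_eqP/andP; split; first by by apply: imsetS; rewrite setCU subsetIl.
    rewrite setCU; apply/subsetP=> k /imsetP[x xS ->]; case: (eqVneq x v) => [->|xv].
      by rewrite -cw imset_f // in_setI wS in_setC in_set1 wv.
    by rewrite imset_f // in_setI xS in_setC in_set1 xv.
  have h1 : #|S :|: [set v]| = #|S|.+1.
    by rewrite setUC cardsU1; move: vS; rewrite in_setC => ->.
  have h2 : #|crossing c (S :|: [set v])| < #|crossing c S|.
    apply/proper_card/properP; split.
      by apply: subset_trans (cr_sub _) _; apply/subsetP=> a; rewrite in_set => /andP[].
    exists e => //; apply: contraL ve => /(subsetP (cr_sub _)); rewrite in_set.
    by case/andP=> _ /subsetP ev; apply/negP=> /ev; rewrite in_setC set11.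
  have h3 : iso_del ep S <= iso_del ep (S :|: [set v]).
    apply/subset_leq_card/subsetP=> x xi; apply: isoP (xi) _; rewrite in_set1.
    apply: contraTneq xi => ->; rewrite inE vS negb_forall; apply/existsP; exists (other v e).
    by rewrite negbK; case/andP: (edge_adj (crE _ ecr) ve).
  have : m * m.+1 * iso_del ep S <= m * m.+1 * iso_del ep (S :|: [set v]).
    by rewrite leq_mul2l h3 orbT.
  by move: h1 h2; clear; lia.
move=> /existsPn alone.
have {}alone v e w : e \in crossing c S -> v \in ends e -> w \notin S -> c w = c v -> w = v.
  move=> ecr ve wS cw; apply/eqP; apply: contraT => wv.
  have := alone v; rewrite negb_exists_in => /forall_inP/(_ e ecr); rewrite ve /=.
  by move/existsPn/(_ w); rewrite in_setC wS wv cw eqxx.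
pose Q := [set v | [exists e in crossing c S, v \in ends e]].
pose N v := [set w | adjS S v w].
have QP v : v \in Q -> exists2 e, e \in crossing c S & v \in ends e.
  by rewrite in_set => /exists_inP[e]; exists e.
(* A non-crossing edge at [v] would give [v] a neighbour with the same label, against [alone]. *)
have QE v e : v \in Q -> v \in ends e -> ends e \subset ~: S -> e \in crossing c S.
  case/QP=> f fcr vf ve eS; rewrite inE eS /=.
  have : other v e != v.
    by rewrite /other; case: ifP => [/eqP <-|/negbT //]; rewrite eq_sym.
  have oS : other v e \notin S.
    by rewrite -in_setC (subsetP eS) //; case/andP: (edge_adj eS ve).
  apply: contraNneq => ce; apply/eqP/(alone _ _ _ fcr vf oS).
  by move: ve ce; rewrite in_set2 /other => /orP[]/eqP->; rewrite ?eqxx // (negPf (noloop e)).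
have [v0 v0Q] : exists v, v \in Q.
  case/set0Pn: crN0 => e ecr; exists (ep e).1.
  by rewrite inE; apply/exists_inP; exists e; rewrite ?set21.
have NS v : N v \subset ~: S by apply/subsetP=> w; rewrite inE => /and3P[].
have NQ v : v \in Q -> N v \subset Q.
  move=> vQ; apply/subsetP=> w; rewrite inE => /adj_edge[e [ve <- eS _]].
  rewrite inE; apply/exists_inP; exists e; first exact: QE vQ ve eS.
  by case/andP: (edge_adj eS ve).
case: (arg_minnP (fun v => #|N v|) v0Q) => v vQ minv; set k := #|N v| in minv *.
have {}vQ : v \in Q by [].
have vS : v \in ~: S.
  by case/QP: vQ => e /crE eS ve; apply: (subsetP eS).
have vN : v \notin N v by rewrite inE; apply/negP=> /adj_edge[e [_ _ _]]; rewrite eqxx.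
pose M := v |: N v.
have cM : #|M| = k.+1 by rewrite cardsU1 vN.
have MQ : M \subset Q by rewrite subUset sub1set vQ NQ.
(* These crossing edges disappear when [N v] joins [S]. Each of the [k.+1] vertices of [M] lies on
   at least [k] of them, one for each neighbour, and every edge has two ends. *)
pose L := [set e in crossing c S | ~~ (ends e \subset ~: N v)].
have degL w : w \in M -> k <= #|[set e in L | w \in ends e]|.
  move=> wM; have wQ := subsetP MQ _ wM; apply: leq_trans (minv w wQ) _.
  apply: leq_trans (leq_imset_card (other w) _).
  apply/subset_leq_card/subsetP=> y; rewrite in_set => /adj_edge[e [we <- eS ne]].
  have ecr := QE _ _ wQ we eS; case/andP: (edge_adj eS we) => aw oe.
  apply: imset_f; rewrite in_set we andbT in_set ecr /=; apply/subsetPn.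
  move: wM; rewrite in_setU1 => /orP[/eqP wv|wN].
    by exists (other w e) => //; rewrite in_setC negbK in_set -wv.
  by exists w; rewrite // in_setC negbK.
have cL : k * k.+1 <= 2 * #|L|.
  have : \sum_(w in M) k <= \sum_(w in M) #|[set e in L | w \in ends e]|.
    by apply: leq_sum => w /degL.
  rewrite sum_nat_const cM mulnC => /leq_trans; apply; rewrite sum_incidence mulnC -sum_nat_const.
  by apply: leq_sum => e _; apply: leq_trans (card_endsI _ _) _; case: (_ \subset _).
have k0 : 0 < k.
  have [e ecr ve] := QP _ vQ.
  rewrite card_gt0; apply/set0Pn; exists (other v e); rewrite inE.
  by case/andP: (edge_adj (crE _ ecr) ve).
have := IHn (S :|: N v) (delS _ (NS v) _); rewrite -card_gt0 => /(_ k0).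
have h1 : #|S :|: N v| = #|S| + k.
  have /eqP dN : N v :&: S == set0 by rewrite setI_eq0 disjoints_subset NS.
  by rewrite cardsU setIC dN cards0 subn0.
have h2 : #|c @: ~: S| <= #|c @: ~: (S :|: N v)| + k.
  apply: leq_trans (leq_add (leqnn _) (leq_imset_card c (N v))).
  rewrite -cardsUI; apply: leq_trans (leq_addr _ _); apply: subset_leq_card.
  rewrite -imsetU setCU setUIl [~: N v :|: _]setUC setUCr setIT; apply: imsetS.
  exact: subsetUl.
have h3 : #|crossing c (S :|: N v)| + #|L| <= #|crossing c S|.
  rewrite -(cardsID [set e | ends e \subset ~: N v] (crossing c S)) leq_add //.
    apply/subset_leq_card/(subset_trans (cr_sub _))/subsetP=> e.
    by rewrite in_set in_setI [_ \in [set _ | _]]in_set.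
  apply/subset_leq_card/subsetP=> e.
  by rewrite in_setD in_set [_ \in [set _ | _]]in_set andbC.
have h4 : iso_del ep S < iso_del ep (S :|: N v).
  apply/proper_card/properP; split.
    apply/subsetP=> x xi; apply: isoP (xi) _; apply: contraTN xi => xN.
    rewrite inE negb_and negb_forall; apply/orP; right; apply/existsP; exists v.
    by rewrite negbK adjC; move: xN; rewrite inE.
  have [e ecr ve] := QP _ vQ.
  exists v; last first.
    rewrite inE negb_and negb_forall; apply/orP; right; apply/existsP; exists (other v e).
    by rewrite negbK; case/andP: (edge_adj (crE _ ecr) ve).
  rewrite inE setCU in_setI vS in_setC vN; apply/forallP=> y; apply/negP=> /and3P[_].
  rewrite in_setI => /andP[yS yN] exy; move: yN; rewrite in_setC in_set => /negP; apply.
  by rewrite /adj vS yS.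
have : m * m.+1 * (iso_del ep S).+1 <= m * m.+1 * iso_del ep (S :|: N v).
  by rewrite leq_mul2l h4 orbT.
have : 2 * m * #|c @: ~: S| <= 2 * m * (#|c @: ~: (S :|: N v)| + k).
  by rewrite leq_mul2l h2 orbT.
have key : 2 * k + 2 * m * k <= k * k.+1 + m * m.+1.
  by case: (leqP k m) => [/subnKC|/subnKC] <-; set d := (_ - _)%N; clear; lia.
rewrite h1; move: h3 cL key; clear; rewrite mulnS !mulnDr; lia.
Qed.

End ComponentBound.

(** * Partition of a base into spanning trees *)

Section TreePacking.
Variables (V E : finType) (ep : E -> V * V).
Implicit Types (F A R : {set E}) (X Y U T : {set V}) (e f g : E) (m : nat) (x y : V).
Local Notation ends := (ends ep).
Local Notation inside := (inside ep).
Local Notation sparse := (sparse ep).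
Local Notation tight := (tight ep).

Lemma adjT_edge F x y : adj ep F [set: V] x y -> exists2 e, e \in F & ends e = [set x; y].
Proof.
case/and3P=> _ _ /exists_inP[e eF]; rewrite /joins => /orP[]/eqP epe; exists e => //;
  by rewrite -[ends e]/[set (ep e).1; (ep e).2] epe //= setUC.
Qed.

Lemma edge_adjT F e : e \in F ->
  adj ep F [set: V] (ep e).1 (ep e).2 /\ adj ep F [set: V] (ep e).2 (ep e).1.
Proof.
move=> eF; rewrite /adj !in_setT /=; split; apply/exists_inP; exists e => //;
  by rewrite /joins -surjective_pairing eqxx ?orbT.
Qed.

(** All of [V] is tight, so an edge leaves any proper component. If [e] lay on a cycle, both its
    ends would lie in one maximal tight set of [T :\ e], which [e] would make overfull. *)
Lemma sparse1_spanning_tree (T : {set E}) : sparse 1 T -> #|T| + 1 = #|V| -> spanning_tree ep T.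
Proof.
move=> spT cT; apply/andP; split.
  apply/forallP=> x; apply/forallP=> y.
  pose U := [set z | connect (adj ep T [set: V]) x z].
  have tT : tight 1 T [set: V].
    by rewrite /tight inside_setT cardsT mul1n cT eqxx andbT; apply/set0Pn; exists x; rewrite inE.
  have xU : x \in U by rewrite inE connect0.
  case: (boolP ([set: V] \subset U)) => [/subsetP/(_ y)|nU].
    by rewrite !inE; apply.
  have TU0 : [set: V] :&: U != set0 by rewrite setTI; apply/set0Pn; exists x.
  have [e] := tight_cut (ltn0Sn 0) spT tT TU0 nU.
  rewrite inside_setT => /edge_adjT[a1 a2] /andP[]; rewrite disjoints_subset !ends_sub.
  rewrite !in_setC -negb_or negbK => nin /orP[] /[dup]; move: nin; rewrite !in_set => nin.
    move=> c1; suff c2 : connect (adj ep T [set: V]) x (ep e).2 by rewrite c1 c2 in nin.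
    exact: connect_trans c1 (connect1 a1).
  move=> c1; suff c2 : connect (adj ep T [set: V]) x (ep e).1 by rewrite c1 c2 in nin.
  exact: connect_trans c1 (connect1 a2).
apply/forall_inP=> e eT; apply/negP=> /connectP[p].
set F := T :\ e; have spF : sparse 1 F by apply: sparseS spT; apply: subD1set.
have [c [cP cmax _]] := tight_partition set0 spF.
set x := (ep e).1; have [tx _ xx] := cP x (negbT (in_set0 x)).
(* Adding a new neighbour to a tight set adds a vertex and at least one edge, so it stays tight,
   against maximality. *)
have step z w : z \in c x -> adj ep F [set: V] z w -> w \in c x.
  move=> zx /adjT_edge[f fF ef]; apply: contraT => wx.
  suff tw : tight 1 F (w |: c x).
    have := cmax x (w |: c x); rewrite tw in_setU1 xx orbT disjoints_subset setC0 subsetT.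
    by move=> /(_ isT isT isT)/subsetP/(_ w); rewrite in_setU1 eqxx (negPf wx) => /(_ isT).
  have w0 : w |: c x != set0 by apply/set0Pn; exists w; rewrite in_setU1 eqxx.
  have := sparseP spF w0; rewrite /tight w0 /= !mul1n cardsU1 wx.
  have := tightP tx; rewrite mul1n.
  have : #|inside F (c x)| < #|inside F (w |: c x)|.
    apply/proper_card/properP; split.
      by apply/subsetP=> a; rewrite !in_set => /andP[-> /subset_trans ->] //; apply: subsetUr.
    exists f; rewrite mem_inside fF ef subUset !sub1set.
      by rewrite !in_setU1 eqxx zx orbT.
    by rewrite (negPf wx) andbF.
  by clear; lia.
have stay : forall z, z \in c x -> path (adj ep F [set: V]) z p -> last z p \in c x.
  by elim: p => //= w p IHp z zx /andP[zw]; apply: IHp; apply: step zw.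
move=> pp lp; have := stay x xx pp; rewrite -lp => yx.
have := sparseP spT (tight_neq0 tx); have := tightP tx.
rewrite -(card_inside_del ep (c x) eT) ends_sub xx yx -/F !mul1n; clear; lia.
Qed.

Section Colouring.
Variables (m : nat) (F : {set E}).
Local Notation colouring := {ffun E -> option 'I_m}.
Implicit Types (col : colouring) (i j : 'I_m) (s : colouring * E).

Definition colour_class col i : {set E} := [set e | col e == Some i].

Lemma sum_colour_class col A :
  \sum_i #|colour_class col i :&: A| = #|[set e in A | isSome (col e)]|.
Proof.
transitivity (\sum_i \sum_(e in A) (col e == Some i)).
  apply: eq_bigr => i _; rewrite -sum1_card big_mkcond [RHS]big_mkcond.
  apply: eq_bigr => e _; rewrite in_setI in_set andbC.
  by case: (e \in A); case: (_ == _).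
rewrite exchange_big -sum1_card big_mkcond [RHS]big_mkcond; apply: eq_bigr => e _.
rewrite in_set; case: (e \in A) => //=; case: (col e) => [k|] /=; last by rewrite big1.
by rewrite (bigD1 k) //= eqxx big1 // => i; rewrite eq_sym => /negPf ik; rewrite [_ == _]ik.
Qed.

Definition recolour col e f i : colouring :=
  [ffun a => if a == e then Some i else if a == f then None else col a].

Lemma recolour_class col e f i j : col e = None -> col f = Some i ->
  colour_class (recolour col e f i) j =
    if j == i then e |: colour_class col i :\ f else colour_class col j.
Proof.
move=> ce cf; apply/setP=> a; case: eqP => [->|/eqP ji].
  rewrite in_set ffunE in_setU1 in_setD1 in_set.
  by case: (eqVneq a e) => [->|_]; [rewrite eqxx|case: (eqVneq a f)].
rewrite !in_set ffunE; case: (eqVneq a e) => [->|_].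
  by rewrite ce; apply/negbTE; rewrite eq_sym; apply: contra ji => /eqP[->].
case: (eqVneq a f) => // ->; rewrite cf; apply/esym/negbTE.
by rewrite eq_sym; apply: contra ji => /eqP[->].
Qed.

(** A partial partition of [F] into [m] forests; [None] marks the edges not placed. *)
Definition valid col : bool :=
  [forall i, sparse 1 (colour_class col i)] && [forall e, (e \notin F) ==> (col e == None)].

(* A state is a colouring with a chosen uncoloured edge; a step gives this edge the colour of
   another one, which becomes the chosen uncoloured edge. *)
Definition exchange s s' : bool :=
  [exists i, [exists f, [&& s.1 f == Some i,
     sparse 1 (s.2 |: colour_class s.1 i :\ f) & s' == (recolour s.1 s.2 f i, f)]]].

Definition ncol col := #|[set e | isSome (col e)]|.

Definition max_state n s : bool :=
  [&& valid s.1, s.2 \in F, s.1 s.2 == None & ncol s.1 == n].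

Lemma exchange_max_state n s s' : exchange s s' -> max_state n s -> max_state n s'.
Proof.
case: s => col e /existsP[i /existsP[f /and3P[/= /eqP cf spf /eqP ->]]].
case/and4P=> /andP[/forallP spc /forallP outF] /= eF /eqP ce /eqP <-.
have ef : f != e by apply: contra_eq_neq cf => ->; rewrite ce.
apply/and4P; split=> /=.
- apply/andP; split.
    by apply/forallP=> j; rewrite recolour_class //; case: eqP.
  apply/forallP=> a; apply/implyP=> aF; rewrite ffunE.
  case: (a =P e) => [ae|_]; first by rewrite ae eF in aF.
  by case: (a =P f) => // _; move/implyP: (outF a); apply.
- by apply: contraT => fF; have := outF f; rewrite fF cf.
- by rewrite ffunE (negPf ef) eqxx.
rewrite /ncol; have -> : [set a | recolour col e f i a] = e |: [set a | col a] :\ f.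
  apply/setP=> a; rewrite in_setU1 in_setD1 !in_set ffunE.
  by case: eqP => // _; case: eqP.
rewrite cardsU1 !inE ce andbF add1n.
by rewrite (cardsD1 f [set a | col a]) in_set cf.
Qed.

(** If no tight set of class [i] spanned [e], giving [e] the colour [i] would colour more than [n]
    edges. *)
Lemma max_state_tight n col e i : (forall col', valid col' -> ncol col' <= n) ->
  max_state n (col, e) ->
  exists T, [/\ tight 1 (colour_class col i) T, ends e \subset T &
    forall Y, tight 1 (colour_class col i) Y -> ends e \subset Y -> T \subset Y].
Proof.
move=> maxn /and4P[/andP[/forallP spc /forallP outF] /= eF /eqP ce /eqP cn].
case: (boolP [exists X : {set V}, tight 1 (colour_class col i) X && (ends e \subset X)]).
  by case/existsP=> X /andP[tX eX]; apply: min_tight tX eX.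
move=> /existsPn noX; exfalso.
have ec : e \notin colour_class col i by rewrite in_set ce.
pose col' : colouring := [ffun a => if a == e then Some i else col a].
have : valid col'.
  apply/andP; split; apply/forallP=> a; last first.
    apply/implyP=> aF; rewrite ffunE; case: (a =P e) => [ae|_]; first by rewrite ae eF in aF.
    by move/implyP: (outF a); apply.
  case: (eqVneq a i) => [->|ai].
    have -> : colour_class col' i = e |: colour_class col i.
      by apply/setP=> b; rewrite in_setU1 !in_set ffunE; case: (b =P e) => //; rewrite eqxx.
    by apply: sparse_add => // X tX; have := noX X; rewrite tX.
  rewrite (_ : colour_class col' a = colour_class col a) //.
  apply/setP=> b; rewrite !in_set ffunE; case: (b =P e) => // ->; rewrite ce.
  by apply/negbTE; rewrite eq_sym; apply: contra ai => /eqP[->].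
move/maxn; rewrite leqNgt -cn => /negP; apply.
rewrite /ncol (_ : [set a | col' a] = e |: [set a | col a]).
  by rewrite cardsU1 in_set ce.
by apply/setP=> a; rewrite in_setU1 !in_set ffunE; case: eqP.
Qed.

Definition reached s0 : {set E} := [set e | [exists col, connect exchange s0 (col, e)]].

(** For a forest [A] this is membership in the closure of [A] in the cycle matroid. *)
Definition spanned A e : bool := [exists X : {set V}, tight 1 A X && (ends e \subset X)].

Lemma max_stateS n s0 s : max_state n s0 -> connect exchange s0 s -> max_state n s.
Proof.
move=> ms /connectP[p]; elim: p s0 ms => [|s1 p IHp] s0 ms /=; first by move=> _ ->.
by case/andP=> /exchange_max_state/(_ ms)/IHp; apply.
Qed.

(** Every edge of class [i] inside the least tight set [T] of [e] can be exchanged for [e] and so is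
    reached; thus [T] stays tight after restriction to reached edges. Exchanging an edge not inside
    [T] would leave [T] overfull. *)
Lemma reached_tight n s0 col e i : (forall col', valid col' -> ncol col' <= n) ->
  max_state n s0 -> connect exchange s0 (col, e) ->
  exists T, [/\ tight 1 (colour_class col i :&: reached s0) T, ends e \subset T &
    forall f, col f = Some i -> sparse 1 (e |: colour_class col i :\ f) -> ends f \subset T].
Proof.
move=> maxn ms0 reach; have ms := max_stateS ms0 reach.
have [T [tT eT minT]] := max_state_tight i maxn ms.
have /and4P[/andP[/forallP/(_ i) spc _] _ /eqP /= ce _] := ms.
have ec : e \notin colour_class col i by rewrite in_set ce.
exists T; split=> //; last first.
  move=> f cf spf; apply: contraT => fT.
  have := sparseP spf (tight_neq0 tT); have := tightP tT.
  rewrite card_inside_add ?inE ?ce ?andbF // eT.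
  have fc : f \in colour_class col i by rewrite in_set cf.
  by rewrite -(card_inside_del ep T fc) (negPf fT); clear; lia.
suff -> : tight 1 (colour_class col i :&: reached s0) T = tight 1 (colour_class col i) T by [].
congr (_ && (#|pred_of_set _| + 1 == _)); apply/setP=> f; rewrite !mem_inside in_setI.
case: (boolP (f \in colour_class col i)) => //= fc.
case: (boolP (ends f \subset T)) => fT; rewrite ?andbF // andbT in_set.
apply/existsP; exists (recolour col e f i); apply: connect_trans reach (connect1 _).
apply/existsP; exists i; apply/existsP; exists f; move: (fc); rewrite in_set => -> /=.
by rewrite eqxx andbT (sparse_exchange spc ec minT) // mem_inside fc.
Qed.

(** In the one class that changes, [e] replaces [f], and both are spanned by a set [C] tight before
    and after. A tight set of the new class spanning [e] is joined with [C]; any other is already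
    tight in the old class. *)
Lemma spanned_exchange n s0 s s' i g : (forall col', valid col' -> ncol col' <= n) ->
  max_state n s0 -> connect exchange s0 s -> exchange s s' ->
  spanned (colour_class s'.1 i :&: reached s0) g ->
  spanned (colour_class s.1 i :&: reached s0) g.
Proof.
move=> maxn ms0 reach ex; have reach' := connect_trans reach (connect1 ex).
have ms := max_stateS ms0 reach; have ms' := max_stateS ms0 reach'.
case: s reach ms ex => col e reach ms.
case/existsP=> k /existsP[f /and3P[/= /eqP cf spf /eqP s'E]].
have /and4P[/andP[/forallP spc _] _ /eqP /= ce _] := ms.
rewrite s'E /= recolour_class //; case: eqP => [->|//].
have [C [tC eC fC]] := reached_tight k maxn ms0 reach.
have {}fC := fC f cf spf.
set R := reached s0 in tC *; set A := colour_class col k :&: R in tC *.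
have eR : e \in R by rewrite inE; apply/existsP; exists col.
have fR : f \in R by rewrite inE; apply/existsP; exists (recolour col e f k); rewrite -s'E.
have fA : f \in A by rewrite in_setI fR andbT in_set cf.
have eA : e \notin A by rewrite !inE ce.
have -> : (e |: colour_class col k :\ f) :&: R = e |: A :\ f.
  apply/setP=> a; rewrite in_setI !in_setU1 !in_setD1 in_setI.
  by case: (eqVneq a e) => [->|_] /=; rewrite ?eR ?andbA.
have eAf : e \notin A :\ f by rewrite in_setD1 (negPf eA) andbF.
have spA : sparse 1 A by apply: sparseS (spc k); apply: subsetIl.
have cin X : #|inside (e |: A :\ f) X| + (ends f \subset X) = #|inside A X| + (ends e \subset X).
  by rewrite card_inside_add // addnAC card_inside_del.
case/existsP=> X /andP[tX gX]; case: (boolP (ends e \subset X)) => eX; last first.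
  apply/existsP; exists X; rewrite gX andbT /tight (tight_neq0 tX) /=.
  have := sparseP spA (tight_neq0 tX); have := cin X; have := tightP tX.
  by rewrite (negPf eX); clear; lia.
have spA' : sparse 1 (e |: A :\ f).
  apply: sparseS spf; apply/setUS/setSD/subsetIl.
have tC' : tight 1 (e |: A :\ f) C.
  by move: tC; have := cin C; rewrite /tight eC fC => /addIn ->.
have e1 := subsetP eX (ep e).1 (set21 _ _); have e1' := subsetP eC (ep e).1 (set21 _ _).
have tXC := tightU spA' tX tC' e1 e1'.
apply/existsP; exists (X :|: C); rewrite (subset_trans gX (subsetUl _ _)) andbT.
move: tXC; have := cin (X :|: C).
rewrite (subset_trans eX (subsetUl _ _)) (subset_trans fC (subsetUr _ _)) => /addIn.
by rewrite /tight => ->.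
Qed.

(** In the state where [g] is uncoloured the claim is immediate; it is pulled back to [s0] along the
    path of exchanges. *)
Lemma reached_spanned n s0 i g : (forall col', valid col' -> ncol col' <= n) ->
  max_state n s0 -> g \in reached s0 -> spanned (colour_class s0.1 i :&: reached s0) g.
Proof.
move=> maxn ms0; rewrite {1}inE => /existsP[col reach].
have : spanned (colour_class (col, g).1 i :&: reached s0) g.
  have [T [tT gT _]] := reached_tight i maxn ms0 reach.
  by apply/existsP; exists T; rewrite tT.
have back p s : connect exchange s0 s -> path exchange s p ->
    spanned (colour_class (last s p).1 i :&: reached s0) g ->
    spanned (colour_class s.1 i :&: reached s0) g.
  elim: p s => [|s1 p IHp] s reach_s; first by [].
  rewrite /= => /andP[ex pp] sp.
  apply: (spanned_exchange maxn ms0 reach_s ex); apply: IHp pp sp.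
  exact: connect_trans reach_s (connect1 ex).
by case/connectP: reach => p pp -> /(back p s0 (connect0 _ _) pp).
Qed.

Lemma sparse_colouring : 0 < m -> sparse m F ->
  exists2 col, valid col & forall e, e \in F -> isSome (col e).
Proof.
move=> m0 spF.
have valid0 : valid [ffun=> None].
  apply/andP; split; apply/forallP=> a; last by rewrite ffunE eqxx implybT.
  rewrite (_ : colour_class _ a = set0) ?sparse0 //.
  by apply/setP=> e; rewrite !inE ffunE.
case: (arg_maxnP ncol valid0) => col vcol maxcol; exists col => // e0 e0F.
case ce0 : (col e0) => //; exfalso.
pose s0 : colouring * E := (col, e0); set n := ncol col.
have maxn col' : valid col' -> ncol col' <= n by apply: maxcol.
have ms0 : max_state n s0 by rewrite /max_state vcol e0F ce0 !eqxx.
set R := reached s0; pose A i := colour_class col i :&: R.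
have spR i e : e \in R -> spanned (A i) e := fun eR => reached_spanned i maxn ms0 eR.
have spA i : sparse 1 (A i).
  by apply: sparseS (subsetIl _ _) _; case/andP: vcol => /forallP.
have e0R : e0 \in R by rewrite inE; apply/existsP; exists col; apply: connect0.
pose x := (ep e0).1; pose i0 := Ordinal m0.
(* [U] is the component of [x] in the forest [A i]. All the [A i] span [R], so these components
   coincide, and the common one is tight in every class. *)
pose blk i U := [/\ tight 1 (A i) U, x \in U &
  forall X z, tight 1 (A i) X -> z \in X -> z \in U -> X \subset U].
have blk_ex i : exists U, blk i U.
  have [c [cP cmax _]] := tight_partition set0 (spA i).
  have [tx _ xx] := cP x (negbT (in_set0 x)); exists (c x); split=> // X z tX zX zU.
  apply: subset_trans (subsetUl _ (c x)) _; apply: (cmax x); first by rewrite inE xx orbT.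
    exact: tightU tX tx zX zU.
  by rewrite disjoints_subset setC0 subsetT.
have blk_sub i j U W : blk i U -> blk j W -> U \subset W.
  move=> [tU xU _] [tW xW maxW]; apply: contraT => nUW.
  have UW0 : U :&: W != set0 by apply/set0Pn; exists x; rewrite inE xU.
  have [e] := tight_cut (ltn0Sn 0) (spA i) tU UW0 nUW.
  rewrite mem_inside => /andP[/setIP[_ eR] _] /andP[neW].
  case/pred0Pn=> z /= /andP[ze zW]; have /existsP[X /andP[tX eX]] := spR j e eR.
  by case/negP: neW; apply: (subset_trans eX); apply: maxW tX (subsetP eX _ ze) zW.
have [U bU] := blk_ex i0.
have tU i : tight 1 (A i) U.
  have [W bW] := blk_ex i; have [tW _ _] := bW.
  suff -> : U = W by [].
  by apply/eqP; rewrite eqEsubset (blk_sub _ _ _ _ bU bW) (blk_sub _ _ _ _ bW bU).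
have e0U : ends e0 \subset U.
  have /existsP[X /andP[tX eX]] := spR i0 e0 e0R; apply: (subset_trans eX).
  by case: bU => _ xU maxU; apply: maxU tX (subsetP eX _ _) xU; rewrite set21.
have U0 : U != set0 := sub_ends_neq0 e0U.
have sumU : \sum_i #|inside (A i) U| + m = m * #|U|.
  have : \sum_i (#|inside (A i) U| + 1) = \sum_(i < m) #|U|.
    by apply: eq_bigr => i _; rewrite (tightP (tU i)) mul1n.
  by rewrite big_split /= !sum_nat_const card_ord muln1.
(* The uncoloured edge [e0] inside [U] makes this strict, against the sparsity of [F]. *)
have : \sum_i #|inside (A i) U| < #|inside F U|.
  apply: (@leq_ltn_trans #|[set e in inside F U | isSome (col e)]|).
    rewrite -sum_colour_class; apply: leq_sum => i _; apply/subset_leq_card/subsetP=> e.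
    rewrite mem_inside in_setI => /andP[/setIP[ec _] eU]; rewrite ec mem_inside eU andbT /=.
    case/andP: vcol => _ /forallP/(_ e); move: ec; rewrite in_set => /eqP ->.
    by rewrite implybF negbK.
  apply/proper_card/properP; split; first by apply/subsetP=> e; rewrite in_set => /andP[].
  by exists e0; rewrite ?mem_inside ?e0F // in_set ce0 andbF.
have := sparseP spF U0; rewrite -sumU leq_add2r.
by move=> /leq_ltn_trans h /h; rewrite ltnn.
Qed.

(** Each of the [m] forests has at most [#|V| - 1] edges and together they have [m] times as many,
    so each is a spanning tree. *)
Lemma base_tree_connected : 0 < m -> sparse m F -> #|F| + m = m * #|V| ->
  tree_connected ep m F.
Proof.
move=> m0 spF cF; have [col /andP[/forallP spc /forallP outF] colF] := sparse_colouring m0 spF.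
have FE : F = [set e in [set: E] | isSome (col e)].
  apply/setP=> e; rewrite !inE /=; apply/idP/idP=> [/colF //|].
  by apply: contraTT => eF; move/implyP: (outF e) => /(_ eF)/eqP ->.
have sumF : \sum_i #|colour_class col i| = #|F|.
  by rewrite FE -sum_colour_class; apply: eq_bigr => i _; rewrite setIT.
have [v0|V0] := posnP #|V|.
  by move: cF; rewrite v0 muln0 => /eqP; rewrite addn_eq0 => /andP[_ /eqP m00]; rewrite m00 in m0.
have T0 : [set: V] != set0 by rewrite -card_gt0 cardsT.
have leV i : #|colour_class col i| + 1 <= #|V|.
  by have := sparseP (spc i) T0; rewrite inside_setT cardsT mul1n.
have eqV i : #|colour_class col i| + 1 = #|V|.
  apply/eqP; rewrite eqn_leq leV /= leqNgt; apply/negP=> lti.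
  have : \sum_i (#|colour_class col i| + 1) < \sum_(i < m) #|V|.
    rewrite (bigD1 i) //= [X in _ < X](bigD1 i) //= -addSn; apply: leq_add => //.
    by apply: leq_sum.
  by rewrite big_split /= sumF !sum_nat_const card_ord muln1 cF ltnn.
exists (colour_class col); split.
  move=> i; apply/subsetP=> e; rewrite inE => /eqP ce; apply: contraT => eF.
  by move/implyP: (outF e) => /(_ eF); rewrite ce.
split; first by move=> i; apply: sparse1_spanning_tree.
move=> i j ij; apply/pred0P=> e /=; apply/negP=> /andP[]; rewrite !inE => /eqP -> /eqP[ij'].
by rewrite ij' eqxx in ij.
Qed.

End Colouring.
End TreePacking.

(** * Existence of a base within the degree bounds *)

Section DegreeBoundedBase.
Variables (V E : finType) (ep : E -> V * V).
Hypothesis noloop : forall e, (ep e).1 != (ep e).2.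
Variable m : nat.
Hypothesis m_gt0 : 0 < m.
Hypothesis component_bound : forall S : {set V},
  m * m.+1 * iso_del ep S + 2 * m * omega_del ep S <= 2 * #|S| + 2 * m.

(** The labelling bound, with its isolated term dropped, is applied to the labels of
    [saturated_count]; the crossing edges cancel. *)
Lemma saturated_inside_ge (F : {set E}) (S : {set V}) : sparse ep m F -> saturated ep m F S ->
  m * #|~: S| <= #|S| + m + #|inside ep F (~: S)|.
Proof.
move=> spF satF; have [c] := saturated_count spF satF.
have := labelling_bound noloop component_bound c S.
move/(leq_trans (leq_addl _ _)); rewrite -mulnA -!mulnDr leq_mul2l /=.
move=> h1 h2; rewrite -(leq_add2r #|crossing ep c S|) -h2.
apply: leq_trans (leq_add h1 (leqnn _)) _.
by rewrite -!addnA addnC -!addnA.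
Qed.

Lemma exists_base (u : V) : exists F, base ep m F.
Proof.
have [F spF satF] := exists_saturated ep m; exists F; rewrite /base spF eqn_leq /=.
have T0 : [set: V] != set0 by apply/set0Pn; exists u.
have := sparseP spF T0; have := saturated_inside_ge spF satF.
by rewrite setC0 inside_setT cardsT cards0 add0n addnC => -> ->.
Qed.

Lemma base_sum_deg_le (F : {set E}) (S : {set V}) : base ep m F -> saturated ep m F S ->
  S != set0 -> \sum_(v in S) deg ep F v + m <= (2 * m + 1) * #|S|.
Proof.
case/andP=> spF /eqP cF satF S0; have := saturated_inside_ge spF satF.
have := sparseP spF S0; have := sum_deg_le ep F S; move: cF.
have <- : #|S| + #|~: S| = #|V| by apply: cardsC.
move: (\sum_(v in S) _) #|inside ep F S| #|inside ep F (~: S)| #|F| #|S| #|~: S|.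
by clear => a b c d s t; lia.
Qed.

Lemma degree_bounded_base (u : V) : exists2 F, base ep m F &
  (forall v, deg ep F v <= 2 * m + 1) /\ deg ep F u <= m + 1.
Proof.
(* The slack [m] in [base_sum_deg_le] pays exactly for lowering the bound at the single vertex
   [u]. *)
pose h v := if v == u then m + 1 else 2 * m + 1.
have [F0 bF0] := exists_base u.
have [F S bF satF S0|F bF leF] := base_deg_bounded (h := h) m_gt0 bF0.
  rewrite -(leq_add2r m); apply: leq_trans (base_sum_deg_le bF satF S0) _.
  have -> : (2 * m + 1) * #|S| = \sum_(v in S) (h v + (if v == u then m else 0)).
    rewrite mulnC -sum_nat_const; apply: eq_bigr => v _; rewrite /h.
    by case: eqP => _; lia.
  rewrite big_split /= leq_add2l -big_mkcondr.
  apply: (@leq_trans (\sum_(v | v == u) m)); last by rewrite big_pred1_eq.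
  rewrite big_mkcond [leqRHS]big_mkcond; apply: leq_sum => v _.
  by case: (v \in S); case: (v == u).
exists F => //; split=> [v|].
  by apply: leq_trans (leF v) _; rewrite /h; case: eqP => _; lia.
by have := leF u; rewrite /h eqxx.
Qed.

End DegreeBoundedBase.

(** * Clearing denominators and conclusion *)

Unset Implicit Arguments.
Local Open Scope ring_scope.

Theorem mainTheorem15 (V E : finType) (ep : E -> V * V)
  (hloop : forall e : E, (ep e).1 != (ep e).2)
  (m : nat) (hm : (0 < m)%N)
  (hcond : forall S : {set V},
     ((m.+1)%:R / 2%:R) * (iso_del ep S)%:R + (omega_del ep S)%:R
       <= (#|S|)%:R / m%:R + 1 :> rat) :
  forall u : V, exists F : {set E},
    tree_connected ep m F /\
    (forall v : V, (deg ep F v <= 2 * m + 1)%N) /\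
    (deg ep F u <= m + 1)%N.
Proof.
move=> u.
have component_bound (S : {set V}) :
    (m * m.+1 * iso_del ep S + 2 * m * omega_del ep S <= 2 * #|S| + 2 * m)%N.
  have m0 : m%:R != 0 :> rat by rewrite pnatr_eq0 -lt0n.
  have := hcond S; rewrite -(ler_pM2l (_ : 0 < 2 * m%:R :> rat)); last first.
    by rewrite mulr_gt0 ?ltr0n.
  rewrite -(ler_nat rat) !natrD !natrM; congr (_ <= _); by field.
have [F bF [degF degu]] := degree_bounded_base hloop hm component_bound u.
exists F; split=> //; case/andP: bF => spF /eqP cF.
exact: base_tree_connected.
Qed.
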